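(* Let $\mathfrak{H}$ be a $p$-homomorph of soluble restricted Lie algebras which contains all atoms. Let $(L,[p])$ be a (not necessarily soluble) restricted Lie algebra, let $K$ be a soluble $[p]$-ideal of $(L,[p])$ and let $S$ be an $\mathfrak{H}$-covering subalgebra of $K$. Then $L=K+\mathcal{N}_L(S)$, where $\mathcal{N}_L(S)$ is the normaliser of $S$ in $L$.
   Context: All Lie algebras are finite-dimensional over a fixed field $F$ of characteristic $p\neq 0$. A restricted Lie algebra $(L,[p])$ is a Lie algebra $L$ with a $p$-operation $x\mapsto x^{[p]}$ in the usual sense; it is soluble if the Lie algebra $L$ is. A $[p]$-subalgebra is a subalgebra $U$ with $U^{[p]}\subseteq U$; a $[p]$-ideal is an ideal which is a $[p]$-subalgebra. For a $[p]$-ideal $K$, $L/K$ carries the induced $p$-operation; a $[p]$-subalgebra carries the restricted $p$-operation. A class of soluble restricted Lie algebras is a collection of such algebras closed under isomorphism (of restricted Lie algebras). A $p$-homomorph is a non-empty class $\mathfrak{H}$ of soluble restricted Lie algebras such that $(L,[p])\in\mathfrak{H}$ and $K$ a $[p]$-ideal of $L$ imply $(L/K,[p])\in\mathfrak{H}$. An atom is a nonzero soluble restricted Lie algebra (necessarily abelian) whose only $[p]$-subalgebras are $0$ and itself. A $[p]$-subalgebra $U$ of a restricted Lie algebra $M$ is an $\mathfrak{H}$-covering subalgebra of $M$ if $U\in\mathfrak{H}$ and, whenever $V$ is a $[p]$-subalgebra of $M$ containing $U$ and $J$ is a $[p]$-ideal of $V$ with $V/J\in\mathfrak{H}$, we have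 $U+J=V$. *)

(* Defs.v *)
From HB Require Import structures.
From mathcomp Require Import all_boot all_order all_algebra.

Set Implicit Arguments.
Unset Strict Implicit.
Unset Printing Implicit Defensive.

Import GRing.Theory.
Local Open Scope ring_scope.

(* Vector F is the class of finite-dimensional F-vector spaces. *)
HB.mixin Record Vector_isLie (F : fieldType) L of Vector F L := {
  lie : L -> L -> L;
  lie_linearl : forall z, linear (fun x => lie x z);
  lie_linearr : forall x, linear (lie x);
  liexx : forall x, lie x x = 0;
  lie_jacobi : forall x y z,
    lie x (lie y z) + lie y (lie z x) + lie z (lie x y) = 0
}.

#[short(type="lieType")]
HB.structure Definition Lie (F : fieldType) :=
  {L of Vector_isLie F L & Vector F L}.

Notation "[ 'lie' x , y ]" := (lie x y)
  (at level 0, format "[ 'lie'  x ,  y ]") : ring_scope.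

HB.instance Definition _ (F : fieldType) (L : lieType F) (x : L) :=
  GRing.isLinear.Build F L L *:%R (lie x) (lie_linearr x).

Section LieTheory.
Variables (F : fieldType) (L : lieType F).
Implicit Types (x y z : L) (U V : {vspace L}).

Lemma lieDl x y z : [lie x + y, z] = [lie x, z] + [lie y, z].
Proof. by have := lie_linearl z 1 x y; rewrite !scale1r. Qed.

Lemma lie0l z : [lie 0, z] = 0.
Proof. by apply: (addrI [lie 0, z]); rewrite -lieDl !addr0. Qed.

Lemma lieZl a x z : [lie a *: x, z] = a *: [lie x, z].
Proof. by have := lie_linearl z a x 0; rewrite !addr0 lie0l addr0. Qed.

Lemma lieC x y : [lie x, y] = - [lie y, x].
Proof.
apply/eqP; rewrite -addr_eq0; apply/eqP.
by have := liexx (x + y); rewrite lieDl !linearD /= !liexx add0r addr0 addrC.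
Qed.

Lemma lieNl x z : [lie - x, z] = - [lie x, z].
Proof. by rewrite -scaleN1r lieZl scaleN1r. Qed.

Lemma lie_suml (I : Type) (r : seq I) (P : pred I) (f : I -> L) z :
  [lie \sum_(i <- r | P i) f i, z] = \sum_(i <- r | P i) [lie f i, z].
Proof.
apply: (big_morph (fun x => [lie x, z])); last exact: lie0l.
by move=> x y; rewrite lieDl.
Qed.

(* The subspace spanned by all brackets [lie u, v], u \in U, v \in V; see
   mem_lie_prod and lie_prod_sub. *)
Definition lie_prod U V : {vspace L} :=
  <<[seq [lie u, v] | u <- vbasis U, v <- vbasis V]>>%VS.

Lemma mem_lie_prod U V u v :
  u \in U -> v \in V -> [lie u, v] \in lie_prod U V.
Proof.
move=> uU vV; rewrite (coord_vbasis uU) (coord_vbasis vV) lie_suml.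
apply: memv_suml => i _; rewrite lieZl; apply: memvZ.
rewrite linear_sum; apply: memv_suml => j _; rewrite linearZ; apply: memvZ.
by apply: memv_span; apply/allpairsP; exists ((vbasis U)`_i, (vbasis V)`_j);
  split => //=; apply: mem_nth; rewrite size_tuple.
Qed.

Lemma lie_prod_sub U V (W : {vspace L}) :
  (forall u v, u \in U -> v \in V -> [lie u, v] \in W) ->
  (lie_prod U V <= W)%VS.
Proof.
move=> UVW; apply/span_subvP => _ /allpairsP[[u v] /= [uU vV ->]].
by apply: UVW; apply: vbasis_mem.
Qed.

Definition derived_series (n : nat) : {vspace L} :=
  iter n (fun U => lie_prod U U) fullv.

Definition soluble : Prop := exists n, derived_series n = 0%VS.

Definition subalgebra U : Prop :=
  forall x y, x \in U -> y \in U -> [lie x, y] \in U.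

Definition ideal U : Prop := forall x y, y \in U -> [lie x, y] \in U.

(* Characterised elementwise by memv_normaliser. *)
Definition normaliser U : {vspace L} :=
  (\bigcap_(i < \dim U) (linfun (lie (vbasis U)`_i) @^-1: U))%VS.

Lemma memv_normaliser U x :
  x \in normaliser U <-> (forall u, u \in U -> [lie x, u] \in U).
Proof.
rewrite memvE; split=> [/subv_bigcapP xN u uU | xN].
  rewrite lieC rpredN (coord_vbasis uU) lie_suml.
  apply: memv_suml => i _; rewrite lieZl; apply: memvZ.
  by have := xN i isT; rewrite -memvE -memv_preim lfunE.
apply/subv_bigcapP => i _; rewrite -memvE -memv_preim lfunE /= lieC rpredN.
by apply/xN/vbasis_mem/mem_nth; rewrite size_tuple.
Qed.

(* jacobson_coef x y n j is the coefficient of X^j in (ad (x X + y))^n (x),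
   computed in L (x) F[X]. *)
Fixpoint jacobson_coef x y (n j : nat) : L :=
  match n, j with
  | 0, 0 => x
  | 0, _ => 0
  | n'.+1, 0 => [lie y, jacobson_coef x y n' 0]
  | n'.+1, j'.+1 =>
      [lie x, jacobson_coef x y n' j'] + [lie y, jacobson_coef x y n' j'.+1]
  end.

(* The terms s_i(x, y), 0 < i < p, of Jacobson's formula, defined by
   (ad (x X + y))^(p-1) (x) = \sum_(1 <= i < p) i s_i(x, y) X^(i-1). *)
Definition jacobson_term (p i : nat) x y : L :=
  (i%:R : F)^-1 *: jacobson_coef x y p.-1 i.-1.

Lemma jacobson_term0 p i x : (1 < p)%N -> jacobson_term p i x 0 = 0.
Proof.
have coef0 n j : jacobson_coef x 0 n.+1 j = 0.
  elim: n j => [|n IHn] [|j].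
  - exact: lie0l.
  - by case: j => [|j]; rewrite /= lie0l ?liexx ?linear0 addr0.
  - exact: lie0l.
  - have -> : jacobson_coef x 0 n.+2 j.+1
        = [lie x, jacobson_coef x 0 n.+1 j]
          + [lie 0, jacobson_coef x 0 n.+1 j.+1] by [].
    by rewrite IHn linear0 lie0l addr0.
by case: p => [|[|n]] // _; rewrite /jacobson_term coef0 scaler0.
Qed.

End LieTheory.

Arguments soluble {F} L.

Lemma jacobson_term_morph (F : fieldType) (L1 L2 : lieType F)
    (f : {linear L1 -> L2}) (p i : nat) (x y : L1) :
    (forall u v, f [lie u, v] = [lie f u, f v]) ->
  f (jacobson_term p i x y) = jacobson_term p i (f x) (f y).
Proof.
move=> fM; rewrite /jacobson_term linearZ; congr (_ *: _).
elim: p.-1 i.-1 => [|n IHn] [|j] //=; rewrite ?linear0 //.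
  by rewrite fM IHn.
by rewrite linearD !fM !IHn.
Qed.

(* Meaningful when p is the characteristic of F. *)
HB.mixin Record Lie_isRestricted (F : fieldType) (p : nat) L of Lie F L := {
  ppow : L -> L;
  ppow_ad : forall x y : L, [lie ppow x, y] = iter p (lie x) y;
  ppowZ : forall (a : F) (x : L), ppow (a *: x) = a ^+ p *: ppow x;
  ppowD : forall x y : L,
    ppow (x + y) = ppow x + ppow y + \sum_(1 <= i < p) jacobson_term p i x y
}.

#[short(type="restrictedLieType")]
HB.structure Definition RestrictedLie (F : fieldType) (p : nat) :=
  {L of Lie_isRestricted F p L & Lie F L}.

Definition restricted_morphism (F : fieldType) (p : nat)
    (L1 L2 : restrictedLieType F p) (f : L1 -> L2) : Prop :=
  [/\ linear f, {morph f : x y / [lie x, y]} & {morph f : x / ppow x}].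

Definition isomorphic (F : fieldType) (p : nat)
    (L1 L2 : restrictedLieType F p) : Prop :=
  exists2 f : L1 -> L2, restricted_morphism f & bijective f.

Record psubalgebra (F : fieldType) (p : nat) (L : restrictedLieType F p) :=
  PSubalgebra {
    psub_space :> {vspace L};
    psub_lie : subalgebra psub_space;
    psub_ppow : forall x, x \in psub_space -> ppow x \in psub_space
  }.

Record pideal (F : fieldType) (p : nat) (L : restrictedLieType F p) :=
  PIdeal {
    pideal_space : {vspace L};
    pideal_lie : ideal pideal_space;
    pideal_ppow : forall x, x \in pideal_space -> ppow x \in pideal_space
  }.

Section Subalgebra.
Variables (F : fieldType) (p : nat) (L : restrictedLieType F p).

Definition psubalgebra_of_pideal (K : pideal L) : psubalgebra L :=
  @PSubalgebra F p L (pideal_space K)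
    (fun x y _ yK => @pideal_lie F p L K x y yK) (@pideal_ppow F p L K).

Coercion psubalgebra_of_pideal : pideal >-> psubalgebra.

Variable U : psubalgebra L.

(* U as a restricted Lie algebra in its own right. *)
Definition subalg_of : Type := subvs_of (psub_space U).
HB.instance Definition _ := Vector.on subalg_of.

Definition subalg_val (x : subalg_of) : L := vsval x.
HB.instance Definition _ := GRing.Linear.copy subalg_val (@vsval F L U).

Definition sub_lie (x y : subalg_of) : subalg_of :=
  Subvs (psub_lie (subvsP x) (subvsP y)).

Definition sub_ppow (x : subalg_of) : subalg_of :=
  Subvs (psub_ppow (subvsP x)).

Fact sub_lie_linearl z : linear (fun x => sub_lie x z).
Proof. by move=> a x y; apply: val_inj; rewrite /= lieDl lieZl. Qed.

Fact sub_lie_linearr x : linear (sub_lie x).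
Proof. by move=> a y z; apply: val_inj; rewrite /= linearP. Qed.

Fact sub_liexx x : sub_lie x x = 0.
Proof. by apply: val_inj; rewrite /= liexx. Qed.

Fact sub_lie_jacobi x y z :
  sub_lie x (sub_lie y z) + sub_lie y (sub_lie z x)
    + sub_lie z (sub_lie x y) = 0.
Proof. by apply: val_inj; rewrite /= lie_jacobi. Qed.

HB.instance Definition _ := Vector_isLie.Build F subalg_of
  sub_lie_linearl sub_lie_linearr sub_liexx sub_lie_jacobi.

Fact sub_ppow_ad (x y : subalg_of) : [lie sub_ppow x, y] = iter p (lie x) y.
Proof.
have iterE n : vsval (iter n (lie x) y) = iter n (lie (vsval x)) (vsval y).
  by elim: n => //= n <-.
by apply: val_inj; rewrite /= ppow_ad -iterE.
Qed.

Fact sub_ppowZ (a : F) (x : subalg_of) :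
  sub_ppow (a *: x) = a ^+ p *: sub_ppow x.
Proof. by apply: val_inj; rewrite /= ppowZ. Qed.

Fact sub_ppowD (x y : subalg_of) :
  sub_ppow (x + y) = sub_ppow x + sub_ppow y
    + \sum_(1 <= i < p) jacobson_term p i x y.
Proof.
apply: val_inj; rewrite /= ppowD; congr (_ + _).
rewrite -[RHS]/(subalg_val _) linear_sum; apply: eq_bigr => i _.
exact/esym/jacobson_term_morph.
Qed.

HB.instance Definition _ := Lie_isRestricted.Build F p subalg_of
  sub_ppow_ad sub_ppowZ sub_ppowD.

(* A subspace of the algebra U viewed as a subspace of L. *)
Definition in_ambient (W : {vspace subalg_of}) : {vspace L} :=
  (linfun subalg_val @: W)%VS.

Lemma mem_in_ambient (W : {vspace subalg_of}) (w : subalg_of) :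
  (subalg_val w \in in_ambient W) = (w \in W).
Proof.
apply/idP/idP => [/memv_imgP[v vW]|wW]; last by rewrite -[subalg_val w]lfunE memv_img.
by rewrite lfunE => /val_inj ->.
Qed.

Lemma subalg_val_morphism :
  restricted_morphism subalg_val /\ injective subalg_val.
Proof. by split; [split=> //; exact: linearP | exact: val_inj]. Qed.

End Subalgebra.

Section Quotient.
Variables (F : fieldType) (p : nat) (L : restrictedLieType F p).
Variable J : pideal L.
Local Notation JV := (pideal_space J).

(* L / J, the coset x + J being encoded by its unique representative in the
   complement JV^C. The projection quot_proj is a surjective morphism with
   kernel J (quot_proj_morphism, quot_proj_surj, quot_proj_ker), which
   determines the structure on quot_of. *)
Definition quot_of : Type := subvs_of (JV^C)%VS.
HB.instance Definition _ := Vector.on quot_of.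

Definition quot_repr (x : quot_of) : L := vsval x.
HB.instance Definition _ :=
  GRing.Linear.copy quot_repr (@vsval F L (JV^C)%VS).

Definition quot_proj (x : L) : quot_of := vsproj (JV^C)%VS (x - projv JV x).

Fact quot_proj_linear : linear quot_proj.
Proof.
move=> a x y; rewrite /quot_proj -[RHS]linearP; congr vsproj.
by rewrite linearP /= scalerBr opprD addrACA.
Qed.
HB.instance Definition _ :=
  GRing.isLinear.Build F L quot_of *:%R quot_proj quot_proj_linear.

Lemma quot_projK x : quot_repr (quot_proj x) = x - projv JV x.
Proof. by rewrite /quot_repr vsprojK // memv_projC. Qed.

Lemma quot_reprK : cancel quot_repr quot_proj.
Proof.
move=> x; have x0 : projv JV (quot_repr x) = 0.
  by apply/eqP; rewrite -memv_ker lker_proj; apply: subvsP.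
by rewrite /quot_proj x0 subr0; apply: vsvalK.
Qed.

Lemma quot_proj_surj (y : quot_of) : exists x, quot_proj x = y.
Proof. by exists (quot_repr y); apply: quot_reprK. Qed.

Lemma quot_proj_ker x : (quot_proj x == 0) = (x \in JV).
Proof.
apply/eqP/idP => [x0 | xJ]; last by rewrite /quot_proj projv_id // subrr linear0.
have /eqP := quot_projK x; rewrite x0 linear0 eq_sym subr_eq0 => /eqP ->.
exact: memv_proj.
Qed.

Definition quot_lie (x y : quot_of) : quot_of :=
  quot_proj [lie quot_repr x, quot_repr y].

Definition quot_ppow (x : quot_of) : quot_of := quot_proj (ppow (quot_repr x)).

Fact quot_proj_lie x y :
  quot_proj [lie x, y] = quot_lie (quot_proj x) (quot_proj y).
Proof.
apply/eqP; rewrite -subr_eq0 /quot_lie -linearB quot_proj_ker !quot_projK.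
set j := projv JV x; set k := projv JV y.
have -> : [lie x, y] - [lie x - j, y - k] = [lie j, y - k] + [lie x, k].
  have -> : [lie x, y] = [lie x, y - k] + [lie x, k] by rewrite -linearD subrK.
  by rewrite lieDl lieNl opprB addrC addrA subrK.
by rewrite memvD // ?[[lie j, _]]lieC ?rpredN;
  apply: pideal_lie; apply: memv_proj.
Qed.

Fact quot_lie_linearl z : linear (fun x => quot_lie x z).
Proof. by move=> a x y; rewrite /quot_lie linearP lieDl lieZl linearP. Qed.

Fact quot_lie_linearr x : linear (quot_lie x).
Proof. by move=> a y z; rewrite /quot_lie !linearP. Qed.

Fact quot_liexx x : quot_lie x x = 0.
Proof. by rewrite /quot_lie liexx linear0. Qed.

Fact quot_lie_jacobi x y z :
  quot_lie x (quot_lie y z) + quot_lie y (quot_lie z x)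
    + quot_lie z (quot_lie x y) = 0.
Proof.
rewrite -[x]quot_reprK -[y]quot_reprK -[z]quot_reprK -!quot_proj_lie.
by rewrite -!linearD /= lie_jacobi linear0.
Qed.

HB.instance Definition _ := Vector_isLie.Build F quot_of
  quot_lie_linearl quot_lie_linearr quot_liexx quot_lie_jacobi.

Fact quot_ppow_ad (x y : quot_of) : [lie quot_ppow x, y] = iter p (lie x) y.
Proof.
have iterE n u v :
    quot_proj (iter n (lie u) v) = iter n (lie (quot_proj u)) (quot_proj v).
  by elim: n => //= n <-; apply: quot_proj_lie.
rewrite -[y]quot_reprK -{2}[x]quot_reprK -iterE -ppow_ad.
exact/esym/quot_proj_lie.
Qed.

Fact quot_ppowZ (a : F) (x : quot_of) :
  quot_ppow (a *: x) = a ^+ p *: quot_ppow x.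
Proof. by rewrite /quot_ppow linearZ /= ppowZ linearZ. Qed.

Fact quot_ppowD (x y : quot_of) :
  quot_ppow (x + y) = quot_ppow x + quot_ppow y
    + \sum_(1 <= i < p) jacobson_term p i x y.
Proof.
rewrite /quot_ppow linearD /= ppowD !linearD /= linear_sum; congr (_ + _).
apply: eq_bigr => i _; rewrite jacobson_term_morph; last exact: quot_proj_lie.
by congr jacobson_term; apply: quot_reprK.
Qed.

HB.instance Definition _ := Lie_isRestricted.Build F p quot_of
  quot_ppow_ad quot_ppowZ quot_ppowD.

Lemma quot_proj_morphism : restricted_morphism quot_proj.
Proof.
split=> [||x]; [exact: linearP | exact: quot_proj_lie | symmetry].
rewrite -[LHS]/(quot_proj (ppow _)) quot_projK ppowD !linearD /= linear_sum.
have /eqP -> : quot_proj (ppow (- projv JV x)) == 0.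
  by rewrite quot_proj_ker pideal_ppow // rpredN memv_proj.
rewrite addr0 big_nat big1 ?addr0 // => i /andP[i1 ip].
rewrite jacobson_term_morph; last exact: quot_proj_lie.
have p1 : (1 < p)%N := leq_ltn_trans i1 ip.
transitivity (jacobson_term p i (quot_proj x) 0); last exact: jacobson_term0.
congr jacobson_term; apply/eqP.
by rewrite [_ == _]quot_proj_ker rpredN memv_proj.
Qed.

End Quotient.

Definition atom (F : fieldType) (p : nat) (A : restrictedLieType F p) : Prop :=
  [/\ (fullv : {vspace A}) <> 0%VS, soluble A
    & forall U : psubalgebra A,
        psub_space U = 0%VS \/ psub_space U = fullv].

Record p_homomorph (F : fieldType) (p : nat)
    (H : restrictedLieType F p -> Prop) : Prop := {
  p_homomorph_nonempty : exists L, H L;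
  p_homomorph_soluble : forall L, H L -> soluble L;
  p_homomorph_iso : forall L1 L2, isomorphic L1 L2 -> H L1 -> H L2;
  p_homomorph_quot : forall L (K : pideal L), H L -> H (quot_of K)
}.

Definition covering_subalgebra (F : fieldType) (p : nat)
    (H : restrictedLieType F p -> Prop) (M : restrictedLieType F p)
    (U : psubalgebra M) : Prop :=
  H (subalg_of U) /\
  forall V : psubalgebra M, (U <= V)%VS ->
  forall J : pideal (subalg_of V), H (quot_of J) ->
    (U + in_ambient J)%VS = V.

(* Main.v *)
Require Import Defs.
From HB Require Import structures.
From mathcomp Require Import all_boot all_order all_algebra.
From Stdlib Require Import Classical.

Set Implicit Arguments.
Unset Strict Implicit.
Unset Printing Implicit Defensive.

Import GRing.Theory.
Local Open Scope ring_scope.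

(** Every x in L has to be corrected by an element of K so that it normalises S.
Since K is an ideal, x maps S into K. The idea is to shrink the target: if x
maps S into a restricted subalgebra U with S < U <= K, then some a in U and some
restricted subalgebra V with S <= V < U are such that x + a maps S into V
([covering_step]). By induction on dim U the target becomes S itself
([covering_normaliser]).

For the step, let Q be a restricted ideal of U maximal subject to S + Q <> U.
Solubility provides a restricted ideal N > Q with N / Q abelian; maximality of Q
makes N / Q a minimal restricted ideal of U / Q with complement (S + Q) / Q
([exists_complemented_factor]). The target is V = S + Q.

- If N / Q is central in U / Q, then V is an ideal of U and U / V, being
  isomorphic to N / Q, is an atom. Atoms lie in H, so the covering property gives
  S + V = U, which is false ([central_quotient_atom]).

- Otherwise N / Q is a nontrivial irreducible S-module. Solubility of S gives
  e in S which acts bijectively on N / Q and such that (ad e)^2 S centralises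
  N / Q ([exists_regular_element]). The map s |-> [x, s] mod V is a derivation
  from S to the S-module U / V, which is N / Q. As e acts surjectively, adding an
  element of N to x makes the derivation vanish at e. If it vanishes on S, the
  step is done. If not, then, because e acts injectively, it does not vanish on
  the centraliser C_S of N / Q in S; by irreducibility it maps C_S onto N / Q, and
  its kernel T satisfies T + C_S = S. With D the intersection of T and C_S,
  replacing the summand C_S / D of S / D by the isomorphic module N / Q turns S / D
  into U / C, where C is the centraliser of N / Q in V. Thus S / D and U / C are
  isomorphic ([deviation_common_quotient]). Now S / D is in H because S is, hence
  so is U / C, and the covering property gives S + C = U although S and C both
  lie in V, a contradiction.

All subalgebras are handled as subspaces of the one algebra L; a quotient of
subspaces is represented by any algebra A with a linear map from L to A that
restricts to a surjective morphism with the prescribed kernel ([quotient_map]). *)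

(** * Extremal subspaces *)

Lemma exists_minimizer (T : Type) (m : T -> nat) (P : T -> Prop) x0 :
  P x0 -> exists2 x, P x & forall y, P y -> (m x <= m y)%N.
Proof.
have [n] := ubnP (m x0); elim: n x0 => // n IHn x0 lt_n Px0.
have [[y [Py lt_y]]|none] := classic (exists y, P y /\ (m y < m x0)%N).
  exact: IHn (leq_trans lt_y lt_n) Py.
exists x0 => // y Py; rewrite leqNgt; apply/negP => lt_y.
by apply: none; exists y.
Qed.

Lemma exists_maximal_vspace (F : fieldType) (V : vectType F)
    (P : {vspace V} -> Prop) U0 :
  P U0 -> exists2 U, P U & forall W, P W -> (U <= W)%VS -> W = U.
Proof.
case/(exists_minimizer (fun U => \dim {:V} - \dim U)%N) => U PU minU.
exists U => // W PW UW; apply/eqP; rewrite eq_sym eqEdim UW /=.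
by have := minU W PW; rewrite leq_sub2lE // dimvS // subvf.
Qed.

Lemma exists_minimal_vspace (F : fieldType) (V : vectType F)
    (P : {vspace V} -> Prop) U0 :
  P U0 -> exists2 U, P U & forall W, P W -> (W <= U)%VS -> W = U.
Proof.
case/(exists_minimizer (fun U => \dim U)) => U PU minU.
by exists U => // W PW WU; apply/eqP; rewrite eqEdim WU minU.
Qed.

(** * Derivations, derived series and centralisers in a Lie algebra *)

Section LieFacts.
Variables (F : fieldType) (L : lieType F).
Implicit Types (x y z : L) (U V W C D N Q X Y : {vspace L}).

Lemma lie_der x y z : [lie x, [lie y, z]] = [lie [lie x, y], z] + [lie y, [lie x, z]].
Proof.
apply/eqP; rewrite -subr_eq0; apply/eqP; rewrite -(lie_jacobi x y z) opprD.
by rewrite [[lie [lie x, y], z]]lieC opprK [[lie x, z]]lieC linearN opprK addrA addrAC.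
Qed.

Lemma iter_lie_mem V x y n :
  (forall v, v \in V -> [lie x, v] \in V) -> y \in V -> iter n (lie x) y \in V.
Proof. by move=> xV yV; elim: n => //= n; apply: xV. Qed.

Definition invariant_by U V := forall u v, u \in U -> v \in V -> [lie u, v] \in V.

Lemma lie_prodS U V : (U <= V)%VS -> (lie_prod U U <= lie_prod V V)%VS.
Proof.
by move=> /subvP UV; apply: lie_prod_sub => u v uU vU; apply: mem_lie_prod; apply: UV.
Qed.

Lemma lie_prod_invariant U D : invariant_by U D -> invariant_by U (lie_prod D D).
Proof.
move=> UD u v uU; move: v; suff/subvP sub :
    (lie_prod D D <= linfun (lie u) @^-1: lie_prod D D)%VS.
  by move=> v /sub; rewrite -memv_preim lfunE.
apply: lie_prod_sub => d d' dD d'D; rewrite -memv_preim lfunE /= lie_der.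
by apply: memvD; apply: mem_lie_prod => //; apply: UD.
Qed.

Definition derived U n := iter n (fun V => lie_prod V V) U.

Definition soluble_sub U := exists n, derived U n = 0%VS.

Lemma soluble_subS U V : (U <= V)%VS -> soluble_sub V -> soluble_sub U.
Proof.
move=> UV [n Vn]; exists n; apply/eqP; rewrite -subv0 -Vn.
by rewrite /derived; elim: {Vn}n => //= n; apply: lie_prodS.
Qed.

(** Applied to a proper ideal C of U this yields a nonzero abelian ideal
(D + C) / C of U / C; D is the last term of the derived series of U that C does not
contain. *)
Lemma last_derived U C : subalgebra U -> soluble_sub U -> ~~ (U <= C)%VS ->
  exists D, [/\ (D <= U)%VS, invariant_by U D, ~~ (D <= C)%VS
    & forall d d', d \in D -> d' \in D -> [lie d, d'] \in C].
Proof.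
move=> sU [n] Un UC; suff rec D : (D <= U)%VS -> invariant_by U D ->
    derived D n = 0%VS -> ~~ (D <= C)%VS ->
  exists D, [/\ (D <= U)%VS, invariant_by U D, ~~ (D <= C)%VS
    & forall d d', d \in D -> d' \in D -> [lie d, d'] \in C].
  exact: (rec U).
elim: n D {Un UC} => [|n IHn] D DU UD Dn DC.
  by move: Dn DC; rewrite /derived /= => ->; rewrite sub0v.
have [DDC|DDC] := boolP (lie_prod D D <= C)%VS.
  by exists D; split=> // d d' dD d'D; apply: (subvP DDC); apply: mem_lie_prod.
apply: (IHn (lie_prod D D)) => //; last by rewrite /derived -iterSr.
  by apply: lie_prod_sub => u v /(subvP DU) uU /(subvP DU); apply: sU.
exact: lie_prod_invariant.
Qed.

(** The elements of U that centralise X modulo Y. *)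
Definition centraliser_mod U X Y : {vspace L} :=
  (U :&: \bigcap_(i < \dim X) (linfun (lie (vbasis X)`_i) @^-1: Y))%VS.

Lemma memv_centraliser_mod U X Y u :
  u \in centraliser_mod U X Y <->
  u \in U /\ (forall x, x \in X -> [lie u, x] \in Y).
Proof.
rewrite memv_cap [X in _ && X]memvE; split=> [/andP[uU /subv_bigcapP uC] | [uU uC]].
  split=> // x xX; rewrite lieC rpredN (coord_vbasis xX) lie_suml.
  apply: memv_suml => i _; rewrite lieZl; apply: memvZ.
  by have := uC i isT; rewrite -memvE -memv_preim lfunE.
rewrite uU; apply/subv_bigcapP => i _; rewrite -memvE -memv_preim lfunE /= lieC rpredN.
by apply/uC/vbasis_mem/mem_nth; rewrite size_tuple.
Qed.

Lemma centraliser_mod_invariant U V X Y :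
    invariant_by V U -> invariant_by V X -> invariant_by V Y ->
  invariant_by V (centraliser_mod U X Y).
Proof.
move=> VU VX VY v u vV /memv_centraliser_mod[uU uC]; apply/memv_centraliser_mod.
split=> [|x xX]; first exact: VU.
have -> : [lie [lie v, u], x] = [lie v, [lie u, x]] - [lie u, [lie v, x]].
  by rewrite lie_der addrK.
by apply: rpredB; [apply/VY/uC | apply/uC/VX].
Qed.

(** Let C be the centraliser in S of the irreducible module N / Q, and D an ideal of S
with D not inside C but [D, D] inside C. The elements of D act on N / Q by commuting
operators, so on a minimal D-submodule X / Q each acts by zero or injectively. If all
acted by zero, the D-invariants of N / Q, which form an S-submodule, would be all of
N / Q, and D would lie in C. So some e in D is injective on X / Q. As
(ad e)^2 S <= [D, D] <= C, the generalised kernel of e on N / Q is an S-submodule; it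
does not contain X / Q, so it vanishes by irreducibility. *)
Lemma exists_regular_element S N Q :
    subalgebra S -> soluble_sub S -> (Q <= N)%VS ->
    invariant_by S N -> invariant_by S Q ->
    (forall T, (Q <= T)%VS -> (T <= N)%VS -> invariant_by S T -> T = Q \/ T = N) ->
    ~ (forall s n, s \in S -> n \in N -> [lie s, n] \in Q) ->
  exists e, [/\ e \in S,
    forall n, n \in N -> [lie e, n] \in Q -> n \in Q
    & forall s n, s \in S -> n \in N -> [lie [lie e, [lie e, s]], n] \in Q].
Proof.
move=> sS solS QN SN SQ minN nontriv.
pose C := centraliser_mod S N Q.
have SC : ~~ (S <= C)%VS.
  apply/negP => /subvP SC; apply: nontriv => s n /SC/memv_centraliser_mod[_]; exact.
have [E [ES SE EC EEC]] := last_derived sS solS SC.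
have actEE a b n : a \in E -> b \in E -> n \in N ->
    [lie a, [lie b, n]] - [lie b, [lie a, n]] \in Q.
  move=> aE bE nN; rewrite lie_der addrK.
  by have /memv_centraliser_mod[_] := EEC a b aE bE; apply.
pose P X := [/\ (Q <= X)%VS, (X <= N)%VS, X <> Q & invariant_by E X].
have PN : P N.
  split=> // [NQ|u v /(subvP ES)]; last exact: SN.
  by apply: nontriv => s n sS' nN; rewrite -NQ; apply: SN.
have [X [QX XN XQ EX] minX] := exists_minimal_vspace PN.
have [n0 n0X n0Q] : exists2 n, n \in X & n \notin Q.
  by apply/subvPn; apply/negP => XsubQ; apply: XQ; apply/eqP; rewrite eqEsubv XsubQ.
have EQ : invariant_by E Q by move=> u v /(subvP ES); apply: SQ.
have dich a : a \in E -> (forall n, n \in X -> [lie a, n] \in Q) \/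
                         (forall n, n \in X -> [lie a, n] \in Q -> n \in Q).
  move=> aE; pose Y := (X :&: linfun (lie a) @^-1: Q)%VS.
  have memY n : (n \in Y) = (n \in X) && ([lie a, n] \in Q).
    by rewrite memv_cap -memv_preim lfunE.
  have [YQ|YQ] := classic (Y = Q).
    by right=> n nX anQ; rewrite -YQ memY nX.
  left=> n; suff <- : Y = X by rewrite memY => /andP[].
  apply: minX; last exact: capvSl.
  split=> //; last 1 first.
  - move=> b n' bE; rewrite !memY => /andP[n'X an'Q].
    rewrite EX //= -[[lie a, _]](subrK [lie b, [lie a, n']]).
    by apply: rpredD; [apply: actEE => //; apply: (subvP XN) | apply: EQ].
  - by apply/subvP => n' n'Q; rewrite memY (subvP QX) ?EQ.
  - exact: subv_trans (capvSl _ _) XN.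
have [e eE einj] : exists2 e, e \in E & forall n, n \in X -> [lie e, n] \in Q -> n \in Q.
  apply: NNPP => none; case/negP: EC; apply/subvP => a aE; apply/memv_centraliser_mod.
  split; first exact: (subvP ES).
  pose T := centraliser_mod N E Q.
  have TE : T = N.
    case: (minN T) => //.
    - apply/subvP => n nQ; apply/memv_centraliser_mod; split; first exact: (subvP QN).
      by move=> b bE; rewrite lieC rpredN EQ.
    - exact: capvSl.
    - exact: centraliser_mod_invariant.
    move=> TQ; case/negP: n0Q; rewrite -TQ; apply/memv_centraliser_mod.
    split=> [|b bE]; first exact: (subvP XN).
    rewrite lieC rpredN; case: (dich b bE) => [|binj]; first exact.
    by case: none; exists b.
  by move=> n; rewrite -{1}TE => /memv_centraliser_mod[_ /(_ a aE)]; rewrite lieC rpredN.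
have eS := subvP ES _ eE.
have ees s n : s \in S -> n \in N -> [lie [lie e, [lie e, s]], n] \in Q.
  move=> sS' nN; have esE : [lie e, s] \in E by rewrite lieC rpredN SE.
  by have /memv_centraliser_mod[_] := EEC e _ eE esE; apply.
exists e; split=> //.
(* K j consists of the n in N with (ad e)^j n in Q. *)
pose K j := iter j (fun T => N :&: linfun (lie e) @^-1: T)%VS Q.
have memK j n : (n \in K j.+1) = (n \in N) && ([lie e, n] \in K j).
  by rewrite memv_cap -memv_preim lfunE.
have KN j : (K j <= N)%VS by case: j => // j; apply: capvSl.
have QK j n : n \in Q -> n \in K j.
  by elim: j n => //= j IHj n nQ; rewrite memK (subvP QN) ?IHj ?SQ.
have KS j n : n \in K j -> n \in K j.+1.
  elim: j n => [|j IHj] n; first by move=> nQ; apply: QK.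
  by rewrite memK => /andP[nN enK]; rewrite memK nN IHj.
have rK r j n : r \in S -> (forall m, m \in N -> [lie [lie e, r], m] \in Q) ->
    n \in K j -> [lie r, n] \in K j.
  move=> rS er; elim: j n => [|j IHj] n; first exact: SQ.
  rewrite !memK => /andP[nN enK]; rewrite SN // andTb lie_der.
  by apply: memvD; [apply/QK/er | apply: IHj].
have sK s j n : s \in S -> n \in K j -> [lie s, n] \in K j.+1.
  move=> sS'; elim: j n => [|j IHj] n; first by move=> nQ; apply/QK/SQ.
  move=> nK; rewrite memK SN ?(subvP (KN _) _ nK) // andTb lie_der.
  apply: memvD; last by apply: IHj; move: nK; rewrite memK => /andP[].
  apply: rK => // [|m mN]; [exact: sS | exact: ees].
(* The chain K is increasing, so a maximal term is its union; sK then makes that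
   term S-invariant. *)
have [T [j ->] maxK] : exists2 T, exists j, T = K j &
    forall W, (exists j, W = K j) -> (T <= W)%VS -> W = T.
  by apply: exists_maximal_vspace; exists 0%N.
have Kj : K j.+1 = K j by apply: maxK; [exists j.+1 | apply/subvP/KS].
have XK i n : n \in X -> n \in K i -> n \in Q.
  elim: i n => // i IHi n nX; rewrite memK => /andP[_ enK].
  by apply: einj => //; apply: IHi => //; apply: EX.
have [KQ|KN'] : K j = Q \/ K j = N.
- apply: minN => //; first exact/subvP/QK.
  by move=> s n sS' nK; rewrite -Kj; apply: sK.
- by move=> n nN enQ; rewrite -KQ -Kj memK nN KQ.
by case/negP: n0Q; apply: (XK j) => //; rewrite KN'; apply: (subvP XN).
Qed.

End LieFacts.

(** * Restricted subalgebras and restricted ideals *)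

Lemma jacobson_term_mem (F : fieldType) (L : lieType F) (p i : nat)
    (V : {vspace L}) x y :
  subalgebra V -> x \in V -> y \in V -> jacobson_term p i x y \in V.
Proof.
move=> sV xV yV; apply: memvZ; elim: p.-1 i.-1 => [|n IHn] [|j] /=; rewrite ?mem0v //.
  exact: sV.
by apply: memvD; apply: sV.
Qed.

Section Restricted.
Variables (F : fieldType) (p : nat).
Hypothesis charFp : p \in [pchar F].
Variable L : restrictedLieType F p.
Implicit Types (x y z : L) (U V W C D J N Q S T X Y : {vspace L}).

Definition restricted_sub U := subalgebra U /\ forall x, x \in U -> ppow x \in U.

Definition restricted_ideal U J :=
  [/\ (J <= U)%VS, invariant_by U J & forall x, x \in J -> ppow x \in J].

Lemma ppow_lie_mem V u x :
  (forall v, v \in V -> [lie u, v] \in V) -> [lie u, x] \in V -> [lie ppow u, x] \in V.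
Proof.
move=> uV uxV; have p_gt0 := prime_gt0 (pcharf_prime charFp).
suff iter_mem : forall n, (0 < n)%N -> iter n (lie u) x \in V by rewrite ppow_ad iter_mem.
by case=> // n _; rewrite iterSr; apply: iter_lie_mem.
Qed.

Lemma restricted_sub_add U S Q :
    restricted_sub S -> (S <= U)%VS -> restricted_ideal U Q ->
  restricted_sub (S + Q).
Proof.
move=> [sS pS] /subvP SU [/subvP QU UQ pQ].
have sSQ : subalgebra (S + Q).
  move=> _ _ /memv_addP[s sS' [q qQ ->]] /memv_addP[s' s'S [q' q'Q ->]].
  rewrite lieDl [[lie s, _]]linearD -addrA memv_add ?sS //=.
  apply: memvD; first by apply: UQ => //; apply: SU.
  by rewrite lieC rpredN; apply: UQ => //; apply: memvD; [apply: SU | apply: QU].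
split=> // _ /memv_addP[s sS' [q qQ ->]]; rewrite ppowD.
have inl : s \in (S + Q)%VS by apply: (subvP (addvSl _ _)).
have inr : q \in (S + Q)%VS by apply: (subvP (addvSr _ _)).
rewrite memvD ?memv_add ?pS ?pQ //; apply: memv_suml => i _.
exact: jacobson_term_mem.
Qed.

Lemma restricted_ideal_centraliser_mod U W X Y :
    restricted_sub U -> restricted_ideal U W -> invariant_by U X -> invariant_by U Y ->
  restricted_ideal U (centraliser_mod W X Y).
Proof.
move=> [sU pU] [WU UW pW] UX UY; split.
- exact: subv_trans (capvSl _ _) WU.
- exact: centraliser_mod_invariant.
move=> c /memv_centraliser_mod[cW cC]; apply/memv_centraliser_mod; split; first exact: pW.
by move=> x xX; apply: ppow_lie_mem; [move=> v; apply/UY/(subvP WU) | apply: cC].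
Qed.

Lemma restricted_ideal_refl U : restricted_sub U -> restricted_ideal U U.
Proof. by case=> sU pU; split. Qed.

(** The chief factor N / Q of U has (S + Q) / Q as a complement in U / Q. *)
Record complemented_factor U S Q N : Prop := {
  factor_bottom : restricted_ideal U Q;
  factor_top : restricted_ideal U N;
  factor_sub : (Q <= N)%VS;
  factor_abelian : forall m n, m \in N -> n \in N -> [lie m, n] \in Q;
  factor_minimal : forall T,
    restricted_ideal U T -> (Q <= T)%VS -> (T <= N)%VS -> T = Q \/ T = N;
  factor_cover : (S + N)%VS = U;
  factor_avoid : (N :&: (S + Q) <= Q)%VS
}.

(** Take Q maximal among the restricted ideals with S + Q <> U. If D is an ideal of U
with D not inside Q and [D, D] <= Q, its p-closure need not be constructed: the double
centraliser N of D modulo Q is automatically a restricted ideal, contains D, and has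
[N, N] <= Q. Every restricted ideal strictly above Q supplements S, which forces
the intersection of N with S + Q to be Q and N / Q to be minimal. *)
Lemma exists_complemented_factor U S :
    restricted_sub U -> soluble_sub U -> restricted_sub S -> (S <= U)%VS -> S <> U ->
  exists Q N, complemented_factor U S Q N /\ (S + Q)%VS <> U.
Proof.
move=> rU solU rS SU SneU; have [sU pU] := rU.
pose P Q := restricted_ideal U Q /\ (S + Q)%VS <> U.
have P0 : P 0%VS.
  split; last by rewrite addv0.
  split; first exact: sub0v.
    by move=> u v _; rewrite !memv0 => /eqP ->; rewrite linear0.
  move=> x; rewrite !memv0 => /eqP ->; rewrite -(scale0r (0 : L)) ppowZ.
  by rewrite expr0n gtn_eqF ?scale0r ?eqxx // (prime_gt0 (pcharf_prime charFp)).
have [Q [rQ SQ] maxQ] := exists_maximal_vspace P0; have [QU UQ pQ] := rQ.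
have UQ' : ~~ (U <= Q)%VS.
  apply/negP => UsubQ; apply: SQ; apply/eqP; rewrite eqEsubv subv_add SU QU.
  exact: subv_trans UsubQ (addvSr _ _).
have [D [DU UD DQ DDQ]] := last_derived sU solU UQ'.
pose Z := centraliser_mod U D Q; pose N := centraliser_mod Z Z Q.
have rZ : restricted_ideal U Z.
  by apply: restricted_ideal_centraliser_mod => //; apply: restricted_ideal_refl.
have rN : restricted_ideal U N.
  by apply: restricted_ideal_centraliser_mod => //; case: rZ.
have QN : (Q <= N)%VS.
  have ideal_lie q u : q \in Q -> u \in U -> [lie q, u] \in Q.
    by move=> qQ uU; rewrite lieC rpredN UQ.
  apply/subvP => q qQ; apply/memv_centraliser_mod; split.
    apply/memv_centraliser_mod; split; first exact: (subvP QU).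
    by move=> d /(subvP DU); apply: ideal_lie.
  by move=> z /memv_centraliser_mod[zU _]; apply: ideal_lie.
have DN : (D <= N)%VS.
  apply/subvP => d dD; apply/memv_centraliser_mod; split.
    apply/memv_centraliser_mod; split; first exact: (subvP DU).
    by move=> d'; apply: DDQ.
  by move=> z /memv_centraliser_mod[_ zD]; rewrite lieC rpredN zD.
have NN m n : m \in N -> n \in N -> [lie m, n] \in Q.
  by move=> /memv_centraliser_mod[_ mZ] /memv_centraliser_mod[nZ _]; apply: mZ.
clearbody N.
have supplement T :
    restricted_ideal U T -> (Q <= T)%VS -> T <> Q -> (S + T)%VS = U.
  by move=> rT QT TQ; apply: NNPP => ST; apply: TQ; apply: maxQ.
have SN : (S + N)%VS = U.
  apply: supplement => // NQ; case/negP: DQ; apply: subv_trans DN _.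
  by rewrite NQ.
have [NU UN pN] := rN.
have [sSQ pSQ] := restricted_sub_add rS SU rQ.
have NSQ : (N :&: (S + Q) <= Q)%VS.
  have rM : restricted_ideal U (N :&: (S + Q)).
    split; first exact: subv_trans (capvSl _ _) NU.
      move=> u v uU /[!memv_cap]/andP[vN vSQ]; apply/andP; split.
        exact: UN.
      move: uU; rewrite -SN => /memv_addP[s sS' [n nN ->]]; rewrite lieDl.
      apply: memvD; first by apply: sSQ => //; apply: (subvP (addvSl _ _)).
      by apply: (subvP (addvSr _ _)); apply: NN.
    by move=> x /[!memv_cap]/andP[xN xSQ]; rewrite pN // pSQ.
  suff -> : (N :&: (S + Q))%VS = Q by [].
  apply: NNPP => MQ; apply: SQ; apply/eqP; rewrite eqEsubv subv_add SU QU /=.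
  rewrite -{1}(supplement _ rM) //; last by rewrite subv_cap QN addvSr.
  by rewrite subv_add addvSl capvSr.
exists Q, N; split=> //; split=> // T rT QT TN.
have [TQ|TQ] := classic (T = Q); [by left | right].
apply/eqP; rewrite eqEsubv TN /=; apply/subvP => n nN.
have := subvP NU n nN; rewrite -(supplement T) // => /memv_addP[s sS' [t tT def_n]].
suff sQ : s \in Q by rewrite def_n memvD // (subvP QT).
apply: (subvP NSQ); rewrite memv_cap (subvP (addvSl _ _)) // andbT.
by have -> : s = n - t; [rewrite def_n addrK | apply: memvB => //; apply: (subvP TN)].
Qed.

(** * Quotients of subalgebras *)

Definition quotient_map U J (A : restrictedLieType F p) (f : {linear L -> A}) :=
  [/\ forall u v, u \in U -> v \in U -> f [lie u, v] = [lie f u, f v],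
      forall u, u \in U -> f (ppow u) = ppow (f u),
      forall u, u \in U -> (f u == 0) = (u \in J)
    & forall a, exists2 u, u \in U & f u = a].

Lemma quotient_map_section U J (A : restrictedLieType F p) (f : {linear L -> A}) :
    quotient_map U J f ->
  exists2 g : {linear A -> L}, forall a, g a \in U & cancel g f.
Proof.
move=> [_ _ _ fsurj]; pose h := (linfun f \o linfun (@vsval F L U))%VF.
have hE u : h u = f (vsval u) by rewrite comp_lfunE !lfunE.
have hK a : h (h^-1%VF a) = a.
  apply: limg_lfunVK; have [u uU <-] := fsurj a.
  by rewrite -[u]/(vsval (Subvs uU)) -hE memv_img ?memvf.
exists (@vsval F L U \o h^-1%VF) => a; first exact: subvsP.
by rewrite /= -hE hK.
Qed.

(** Two quotients of U by J agree: lift along a linear section of f, then apply g. *)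
Lemma quotient_map_iso U J (A B : restrictedLieType F p)
    (f : {linear L -> A}) (g : {linear L -> B}) :
    restricted_sub U ->
  quotient_map U J f -> quotient_map U J g -> isomorphic A B.
Proof.
move=> [sU pU] qf qg.
have [f' f'U f'K] := quotient_map_section qf; have [g' g'U g'K] := quotient_map_section qg.
have [fM fp fker fsurj] := qf; have [gM gp gker gsurj] := qg.
have gf' u : u \in U -> g (f' (f u)) = g u.
  move=> uU; have dU : f' (f u) - u \in U by apply: memvB.
  by apply/eqP; rewrite -subr_eq0 -linearB gker // -fker // linearB /= f'K subrr.
have fg' u : u \in U -> f (g' (g u)) = f u.
  move=> uU; have dU : g' (g u) - u \in U by apply: memvB.
  by apply/eqP; rewrite -subr_eq0 -linearB fker // -gker // linearB /= g'K subrr.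
exists (g \o f'); last first.
  by exists (f \o g') => a /=; [rewrite fg' ?f'K | rewrite gf' ?g'K].
split; first exact: linearP.
  move=> a b /=; rewrite -[in RHS]gM // -[in RHS]gf' ?sU //.
  by rewrite fM // !f'K.
by move=> a /=; rewrite -[in RHS]gp // -[in RHS]gf' ?pU // fp // f'K.
Qed.

(** A restricted subalgebra U of L may arise as the image of an algebra M, for instance
of a subalgebra of a subalgebra of L. Its quotients are then those of M. *)
Lemma quotient_of_embedding (M : restrictedLieType F p) (i : {linear M -> L}) U J :
    {morph i : a b / [lie a, b]} -> {morph i : a / ppow a} -> injective i ->
    (forall u, u \in U <-> exists a, i a = u) -> restricted_ideal U J ->
  exists K : pideal M, (forall a, (a \in pideal_space K) = (i a \in J)) /\
    exists f : {linear L -> quot_of K}, quotient_map U J f.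
Proof.
move=> iM ip iinj imi [JU UJ pJ]; pose KV := (linfun i @^-1: J)%VS.
have memK a : (a \in KV) = (i a \in J) by rewrite -memv_preim lfunE.
have iU a : i a \in U by apply/imi; exists a.
have K_ideal : ideal KV.
  by move=> a b; rewrite !memK iM => bJ; apply: UJ.
have K_ppow b : b \in KV -> ppow b \in KV by rewrite !memK ip; apply: pJ.
pose K := PIdeal K_ideal K_ppow; exists K; split; first exact: memK.
have iK : cancel i (linfun i)^-1%VF.
  move=> a; rewrite -[i a]lfunE lker0_lfunK //.
  by apply/lker0P => b c; rewrite !lfunE; apply: iinj.
have [_ qM qp] := quot_proj_morphism K.
exists (@quot_proj F p M K \o (linfun i)^-1%VF); split=> /=.
- by move=> u v /imi[a <-] /imi[b <-]; rewrite -iM !iK.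
- by move=> u /imi[a <-]; rewrite -ip !iK.
- by move=> u /imi[a <-]; rewrite iK quot_proj_ker memK.
by move=> y; have [a <-] := quot_proj_surj y; exists (i a); rewrite //= iK.
Qed.

Lemma exists_quotient_map U J :
  restricted_sub U -> restricted_ideal U J ->
  exists (A : restrictedLieType F p) (f : {linear L -> A}), quotient_map U J f.
Proof.
move=> [sU pU] rJ; pose V := PSubalgebra sU pU.
have [[_ vM vp] vinj] := subalg_val_morphism V.
have [|K [_ [f qf]]] := @quotient_of_embedding _ (@subalg_val F p L V) U J vM vp vinj _ rJ.
  move=> u; split=> [uU | [a <-]]; last exact: subvsP.
  by exists (Subvs uU : subalg_of V).
by exists (quot_of K), f.
Qed.

End Restricted.

(** * A complemented chief factor *)

Section ChiefFactor.
Variables (F : fieldType) (p : nat).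
Hypothesis charFp : p \in [pchar F].
Variables (L : restrictedLieType F p) (U S Q N : {vspace L}).
Implicit Types (x y z : L) (C D J T X Y : {vspace L}).

Hypotheses (rU : restricted_sub U) (rS : restricted_sub S) (SU : (S <= U)%VS).
Hypothesis UNQ : complemented_factor U S Q N.

Local Notation W := (S + Q)%VS.

Let rQ : restricted_ideal U Q := factor_bottom UNQ.
Let rN : restricted_ideal U N := factor_top UNQ.
Let QN : (Q <= N)%VS := factor_sub UNQ.
Let NN : forall m n, m \in N -> n \in N -> [lie m, n] \in Q := factor_abelian UNQ.
Let SN : (S + N)%VS = U := factor_cover UNQ.
Let QU u : u \in Q -> u \in U. Proof. by case: rQ => /subvP QU _ _; apply: QU. Qed.
Let UQ : invariant_by U Q. Proof. by case: rQ. Qed.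
Let NU u : u \in N -> u \in U. Proof. by case: rN => /subvP NU _ _; apply: NU. Qed.
Let UN : invariant_by U N. Proof. by case: rN. Qed.
Let inSU s : s \in S -> s \in U. Proof. exact: subvP. Qed.
Let inSW s : s \in S -> s \in W. Proof. exact/subvP/addvSl. Qed.
Let inQW q : q \in Q -> q \in W. Proof. exact/subvP/addvSr. Qed.
Let inQN q : q \in Q -> q \in N. Proof. exact: subvP. Qed.
Let QUr u q : u \in U -> q \in Q -> [lie q, u] \in Q.
Proof. by move=> uU qQ; rewrite lieC rpredN; apply: UQ. Qed.
Let rW : restricted_sub W. Proof. exact: restricted_sub_add rS SU rQ. Qed.
Let NW n : n \in N -> n \in W -> n \in Q.
Proof. by move=> nN nW; apply: (subvP (factor_avoid UNQ)); rewrite memv_cap nN nW. Qed.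
Let splitU u : u \in U -> exists s n, [/\ s \in S, n \in N & u = s + n].
Proof. by rewrite -SN => /memv_addP[s sS [n nN ->]]; exists s, n. Qed.
Let inWU w : w \in W -> w \in U.
Proof. by case/memv_addP=> s sS [q qQ ->]; apply: memvD; [apply: inSU | apply: QU]. Qed.
Let splitWN u : u \in U -> exists w n, [/\ w \in W, n \in N & u = w + n].
Proof. by case/splitU=> s [n [sS nN ->]]; exists s, n; split=> //; apply: inSW. Qed.

(** S + Q is stable under S, and N maps it into [N, U] <= Q. *)
Lemma central_restricted_ideal :
  (forall u n, u \in U -> n \in N -> [lie u, n] \in Q) -> restricted_ideal U W.
Proof.
move=> central; split; [by rewrite -SN addvS | | by case: rW].
move=> u w /splitU[s [n [sS nN ->]]] wW; rewrite lieDl.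
apply: memvD; first by case: rW => sW _; apply: sW => //; apply: inSW.
by rewrite lieC rpredN; apply/inQW/central => //; apply: inWU.
Qed.

(** U / (S + Q) is isomorphic to N / Q. When N / Q is central, every restricted
subalgebra of it is an ideal, so minimality leaves only the trivial ones. *)
Lemma central_quotient_atom (A : restrictedLieType F p) (f : {linear L -> A}) :
    (forall u n, u \in U -> n \in N -> [lie u, n] \in Q) -> W <> U ->
  quotient_map U W f -> atom A.
Proof.
move=> central WneU [fM fp fker fsurj].
have fW w : w \in W -> f w = 0.
  by move=> wW; apply/eqP; rewrite fker // inWU.
have fN a : exists2 n, n \in N & f n = a.
  have [u /splitU[s [n [sS nN ->]]] <-] := fsurj a.
  by exists n => //; rewrite linearD [f s]fW ?add0r //; apply: inSW.
split.
- move=> A0; apply: WneU; apply/eqP; rewrite eqEsubv -{1}SN addvS //=.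
  apply/subvP => u uU; rewrite -fker //.
  by have := memvf (f u); rewrite A0 memv0.
- exists 1%N; apply/eqP; rewrite -subv0; apply: lie_prod_sub => a b _ _.
  have [[m mN <-] [n nN <-]] := (fN a, fN b).
  by rewrite -fM ?NU // fW ?mem0v //; apply/inQW/NN.
move=> X; pose T := (N :&: linfun f @^-1: psub_space X)%VS.
have memT n : (n \in T) = (n \in N) && (f n \in psub_space X).
  by rewrite memv_cap -memv_preim lfunE.
have QT q : q \in Q -> q \in T by move=> qQ; rewrite memT inQN ?fW ?mem0v ?inQW.
have rT : restricted_ideal U T.
  split.
  - by apply/subvP => n; rewrite memT => /andP[/NU].
  - by move=> u n uU; rewrite memT => /andP[nN _]; apply/QT/central.
  move=> n; rewrite !memT => /andP[nN fnX]; apply/andP; split.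
    by case: rN => _ _; apply.
  by rewrite fp ?NU // psub_ppow.
have [||TQ|TN] := factor_minimal UNQ rT.
- by apply/subvP.
- exact: capvSl.
- left; apply/eqP; rewrite -subv0; apply/subvP => a; have [n nN <-] := fN a.
  by move=> fnX; rewrite fW ?mem0v // inQW // -TQ memT nN.
right; apply/vspaceP => a; rewrite memvf; have [n nN <-] := fN a.
by move: nN; rewrite -{1}TN memT => /andP[].
Qed.

Hypothesis noncentral : ~ (forall u n, u \in U -> n \in N -> [lie u, n] \in Q).

(** The centre of U / Q meets N / Q in a restricted ideal, and that is not all of N / Q
because N / Q is not central. *)
Lemma chief_centre n : n \in N -> (forall u, u \in U -> [lie n, u] \in Q) -> n \in Q.
Proof.
have UU : invariant_by U U by case: rU.
have rZ : restricted_ideal U (centraliser_mod N U Q).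
  exact: restricted_ideal_centraliser_mod.
move=> nN nU; have [||<-|ZN] := factor_minimal UNQ rZ.
- apply/subvP => q qQ; apply/memv_centraliser_mod; split; first exact: inQN.
  by move=> u uU; apply: QUr.
- exact: capvSl.
- exact/memv_centraliser_mod.
case: noncentral => u m uU; rewrite -{1}ZN => /memv_centraliser_mod[_ mU].
by rewrite lieC rpredN; apply: mU.
Qed.

(** For n in N and u in U, [n^p, u] = (ad n)^p u lies in [N, N] <= Q because p > 1, so
the p-th power of n is central modulo Q. *)
Lemma chief_ppow n : n \in N -> ppow n \in Q.
Proof.
move=> nN; apply: chief_centre; first by case: rN => _ _; apply.
move=> u uU.
have nu : [lie n, u] \in N by rewrite lieC rpredN; apply: UN.
have p_gt1 := prime_gt1 (pcharf_prime charFp).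
suff act k : (1 < k)%N -> iter k (lie n) u \in Q by rewrite ppow_ad act.
case: k => [|[|k]] // _; rewrite !iterSr; apply: iter_lie_mem; last exact: NN.
by move=> v; apply/UQ/NU.
Qed.

(** As p-th powers of elements of N lie in Q, any subspace between Q and N is closed
under the p-operation; as N acts trivially on N / Q, being invariant under S is the
same as being an ideal of U. *)
Lemma chief_irreducible T :
  (Q <= T)%VS -> (T <= N)%VS -> invariant_by S T -> T = Q \/ T = N.
Proof.
move=> /subvP QT TN ST; apply: (factor_minimal UNQ) => //; last exact/subvP.
split.
- by apply/subvP => t /(subvP TN)/NU.
- move=> u t /splitU[s [n [sS nN ->]]] tT; rewrite lieDl.
  by apply: memvD; [apply: ST | apply/QT/NN => //; apply: (subvP TN)].
by move=> t /(subvP TN)/chief_ppow/QT.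
Qed.

Let SQ : invariant_by S Q. Proof. by move=> s q sS; apply/UQ/inSU. Qed.

Lemma exists_regular_in_S : soluble_sub S ->
  exists e, [/\ e \in S,
    forall n, n \in N -> [lie e, n] \in Q -> n \in Q
    & forall s n, s \in S -> n \in N -> [lie [lie e, [lie e, s]], n] \in Q].
Proof.
move=> solS; apply: exists_regular_element => //.
- by case: rS.
- by move=> s n sS; apply/UN/inSU.
- exact: chief_irreducible.
move=> Scentral; apply: noncentral => u n /splitU[s [m [sS mN ->]]] nN.
by rewrite lieDl; apply: memvD; [apply: Scentral | apply: NN].
Qed.

(** ad e induces an endomorphism of N / Q; injectivity gives surjectivity by counting
dimensions. *)
Lemma regular_surjective e : e \in U ->
    (forall n, n \in N -> [lie e, n] \in Q -> n \in Q) ->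
  forall n, n \in N -> exists2 a, a \in N & n - [lie e, a] \in Q.
Proof.
move=> eU einj n; pose g := linfun (lie e).
have gQ : (g @: Q <= Q)%VS.
  by apply/subvP => _ /memv_imgP[q qQ ->]; rewrite lfunE; apply: UQ.
have kerNQ : (N :&: lker g = Q :&: lker g)%VS.
  apply/eqP; rewrite eqEsubv [X in _ && X]capvS // subv_cap capvSr !andbT.
  apply/subvP => m; rewrite memv_cap memv_ker lfunE => /andP[mN /eqP em0].
  by apply: einj => //; rewrite em0 mem0v.
have cap : (g @: N :&: Q = g @: Q)%VS.
  apply/eqP; rewrite eqEsubv [X in _ && X]subv_cap gQ limgS // !andbT.
  apply/subvP => m; rewrite memv_cap => /andP[/memv_imgP[a aN ->]].
  by rewrite lfunE => /(einj a aN) aQ; apply/memv_imgP; exists a; rewrite ?lfunE.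
have gN : (g @: N + Q = N)%VS.
  apply/eqP; rewrite eqEdim subv_add QN andbT; apply/andP; split.
    by apply/subvP => _ /memv_imgP[a aN ->]; rewrite lfunE; apply: UN.
  rewrite -(leq_add2r (\dim (g @: Q))) -{2}cap dimv_sum_cap.
  by rewrite -(limg_ker_dim g N) kerNQ -(limg_ker_dim g Q) addnCA addnA.
rewrite -{1}gN => /memv_addP[_ /memv_imgP[a aN ->] [q qQ ->]].
by exists a; rewrite // lfunE addrC addKr.
Qed.


(** * A derivation of S into the chief factor that is not inner *)

(** The map s |-> [x, s] is regarded as a derivation from S to the S-module U / W, which
is N / Q. It vanishes at e but not on S. The kernel of the derivation is T, and Cs is the
centraliser of N / Q in S. *)

Variables (x e : L).
Hypothesis xS : forall s, s \in S -> [lie x, s] \in U.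
Hypotheses (eS : e \in S) (xe : [lie x, e] \in W).
Hypothesis einj : forall n, n \in N -> [lie e, n] \in Q -> n \in Q.
Hypothesis ees :
  forall s n, s \in S -> n \in N -> [lie [lie e, [lie e, s]], n] \in Q.

Let Cs := centraliser_mod S N Q.
Let T := (S :&: linfun (lie x) @^-1: W)%VS.

Let memT s : (s \in T) = (s \in S) && ([lie x, s] \in W).
Proof. by rewrite memv_cap -memv_preim lfunE. Qed.
Let TS t : t \in T -> t \in S. Proof. by rewrite memT => /andP[]. Qed.
Let CsS c : c \in Cs -> c \in S. Proof. by case/memv_centraliser_mod. Qed.
Let CsN c n : c \in Cs -> n \in N -> [lie c, n] \in Q.
Proof. by case/memv_centraliser_mod=> _; apply. Qed.
Let rCs : restricted_ideal S Cs.
Proof.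
apply: restricted_ideal_centraliser_mod => //; first exact: restricted_ideal_refl.
by move=> s n sS; apply/UN/inSU.
Qed.
Let sW : subalgebra W. Proof. by case: rW. Qed.
Let CsUW c u : c \in Cs -> u \in U -> [lie c, u] \in W.
Proof.
move=> cC /splitU[s [n [sS nN ->]]]; rewrite linearD; apply: memvD.
  by apply: sW; apply: inSW => //; apply: CsS.
by apply/inQW/CsN.
Qed.

Let T_lie : subalgebra T.
Proof.
have [sS _] := rS; move=> s t; rewrite !memT => /andP[sS' xs] /andP[tS xt].
rewrite sS //= lie_der; apply: memvD; apply: sW => //; exact: inSW.
Qed.

Let memT_ppow c : c \in Cs -> [lie x, ppow c] \in W.
Proof.
move=> cC; rewrite lieC rpredN.
have p_gt1 := prime_gt1 (pcharf_prime charFp).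
suff act k : (1 < k)%N -> iter k (lie c) x \in W by rewrite ppow_ad act.
case: k => [|[|k]] // _; rewrite !iterSr; apply: iter_lie_mem.
  by move=> w /inWU; apply: CsUW.
by apply: CsUW => //; rewrite lieC rpredN; apply/xS/CsS.
Qed.

Let D := (T :&: Cs)%VS.

Let rD : restricted_ideal S D.
Proof.
split.
- by apply/subvP => d /memv_capP[/TS].
- move=> s d sS /memv_capP[dT dC]; apply/memv_capP.
  have sdC : [lie s, d] \in Cs by case: rCs => _ SCs _; apply: SCs.
  split=> //; rewrite memT (CsS sdC) lie_der; apply: memvD.
    by rewrite lieC rpredN; apply: CsUW => //; apply: xS.
  by apply: sW; [apply: inSW | move: dT; rewrite memT => /andP[]].
move=> d /memv_capP[dT dC]; apply/memv_capP.
have pdC : ppow d \in Cs by case: rCs => _ _; apply.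
by split=> //; rewrite memT (CsS pdC) memT_ppow.
Qed.

Hypothesis deviates : exists2 s, s \in S & [lie x, s] \notin W.

(* The image of Cs under the derivation is an S-submodule Y of N / Q. Were it zero, the
   derivation would vanish at [e, [e, s]], which lies in Cs; modulo W its value there
   is (ad e)^2 [x, s], because it vanishes at e, and injectivity of e would give
   [x, s] in W for all s. *)
Let onto n : n \in N -> exists c w, [/\ c \in Cs, w \in W & [lie x, c] = w + n].
Proof.
pose g := linfun (lie x); pose Y := (N :&: (g @: Cs + W))%VS.
have memY m : m \in Y <-> m \in N /\
    exists c w, [/\ c \in Cs, w \in W & m = [lie x, c] + w].
  rewrite memv_cap; split=> [/andP[mN /memv_addP[_ /memv_imgP[c cC ->] [w wW def_m]]]|].
    by split=> //; exists c, w; split; rewrite // def_m lfunE.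
  case=> mN [c [w [cC wW def_m]]]; rewrite mN def_m memv_add //.
  by rewrite -[[lie x, c]](lfunE (lie x)) memv_img.
suff YN : Y = N.
  rewrite -YN => /memY[_ [c [w [cC wW ->]]]]; exists c, (- w).
  by split=> //; rewrite ?rpredN // addrC addrK.
have [|||YQ|//] := @chief_irreducible Y; last 1 first.
- have xCs c : c \in Cs -> [lie x, c] \in W.
    move=> cC; have /splitWN[w [m [wW mN def]]] := xS (CsS cC).
    rewrite def; apply: memvD => //; apply: inQW; rewrite -YQ; apply/memY.
    by split=> //; exists c, (- w); split; rewrite ?rpredN // def addrC addKr.
  have [s sS /negP[]] := deviates; have /splitWN[w [m [wW mN def]]] := xS sS.
  rewrite def memvD // inQW //; apply: einj => //; apply: einj.
    by apply: UN => //; apply: inSU.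
  have sS' : subalgebra S by case: rS.
  have esS : [lie e, s] \in S by apply: sS'.
  have eesC : [lie e, [lie e, s]] \in Cs.
    by apply/memv_centraliser_mod; split=> [|n1]; [apply: sS' | apply: ees].
  have step y z : y \in S -> [lie x, y] - z \in W -> [lie x, [lie e, y]] - [lie e, z] \in W.
    move=> yS xym; rewrite lie_der -addrA -linearB.
    by apply: memvD; apply: sW => //; apply: inSW.
  apply: NW; first by do 2!(apply: UN; first exact: inSU).
  rewrite -[[lie e, _]](subKr [lie x, [lie e, [lie e, s]]]); apply: memvB; first exact: xCs.
  by apply: (step) => //; apply: (step) => //; rewrite def addrK.
- apply/subvP => q qQ; apply/memY; split; first exact: inQN.
  by exists 0, q; rewrite mem0v linear0 add0r inQW.
- exact: capvSl.
move=> s m sS /memY[mN [c [w [cC wW def_m]]]]; apply/memY.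
split; first by apply: UN => //; apply: inSU.
exists [lie s, c], ([lie s, w] - [lie [lie x, s], c]); split.
- by case: rCs => _ SCs _; apply: SCs.
- apply: memvB; first by apply: sW => //; apply: inSW.
  by rewrite lieC rpredN; apply: CsUW => //; apply: xS.
by rewrite def_m linearD /= [[lie x, [lie s, c]]]lie_der addrACA addrC addrA subrK addrC.
Qed.

(* C = Cs + Q, the centraliser of N / Q in W. *)
Let C := (W :&: centraliser_mod U N Q)%VS.

Let memC c : c \in C <-> c \in W /\ (forall n, n \in N -> [lie c, n] \in Q).
Proof.
split=> [/memv_capP[cW /memv_centraliser_mod[_ cN]] // | [cW cN]].
by apply/memv_capP; split=> //; apply/memv_centraliser_mod; split=> //; apply: inWU.
Qed.

Let QC q : q \in Q -> q \in C.
Proof.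
by move=> qQ; apply/memC; split=> [|n nN]; [apply: inQW | apply: QUr => //; apply: NU].
Qed.
Let CsC c : c \in Cs -> c \in C.
Proof. by move=> cC; apply/memC; split=> [|n]; [apply/inSW/CsS | apply: CsN]. Qed.

Let rC : restricted_ideal U C.
Proof.
have UU : restricted_ideal U U by apply: restricted_ideal_refl.
have [_ UCU pCU] : restricted_ideal U (centraliser_mod U N Q).
  exact: restricted_ideal_centraliser_mod.
split.
- by apply/subvP => c /memv_capP[/inWU].
- move=> u c uU /memv_capP[cW cC]; apply/memv_capP; split; last exact: UCU.
  case: (splitU uU) => s [n [sS nN ->]]; rewrite lieDl; apply: memvD.
    by apply: sW => //; apply: inSW.
  by rewrite lieC rpredN; apply: inQW; case/memv_centraliser_mod: cC => _; apply.
by move=> c /memv_capP[cW cC]; apply/memv_capP; split; [case: rW => _; apply | apply: pCU].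
Qed.

Let splitS s : s \in S -> exists t c, [/\ t \in T, c \in Cs & s = t + c].
Proof.
move=> sS; have /splitWN[w [n [wW nN def]]] := xS sS.
have [c [w' [cC w'W defc]]] := onto nN.
exists (s - c), c; split; rewrite ?subrK //.
have cS := CsS cC; rewrite memT memvB //= linearB /= def defc opprD addrACA subrr addr0.
exact: memvB.
Qed.

(* The correspondence between S and U that fixes T and sends c in Cs to the value n of
   the derivation at c. It is single valued modulo C, so psi below, which picks its
   values linearly, induces the isomorphism from S / D to U / C. *)
Let R s u := exists t c n w, [/\ t \in T, c \in Cs, n \in N & w \in W] /\
  [/\ s = t + c, [lie x, c] = w + n & u = t + n].

Let R_linear a s1 u1 s2 u2 : R s1 u1 -> R s2 u2 -> R (a *: s1 + s2) (a *: u1 + u2).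
Proof.
case=> t1 [c1 [n1 [w1 [[tT1 cC1 nN1 wW1] [-> def1 ->]]]]].
case=> t2 [c2 [n2 [w2 [[tT2 cC2 nN2 wW2] [-> def2 ->]]]]].
exists (a *: t1 + t2), (a *: c1 + c2), (a *: n1 + n2), (a *: w1 + w2).
by split; split; rewrite ?memvD ?memvZ // ?linearP /= ?def1 ?def2 !scalerDr addrACA.
Qed.

Let R0 u : R 0 u -> u \in C.
Proof.
case=> t [c [n [w [[tT cC nN wW] [def0 defc ->]]]]].
have def_t : t = - c by apply/eqP; rewrite -addr_eq0 -def0.
apply: memvD; first by rewrite def_t rpredN CsC.
apply/QC/NW => //; rewrite -[n](addKr w) -defc addrC; apply: memvB => //.
by have := tT; rewrite def_t rpredN memT => /andP[].
Qed.

Let R_uniq s u u' : R s u -> R s u' -> u' - u \in C.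
Proof.
move=> Ru Ru'; apply: R0; have := R_linear (-1) Ru Ru'.
by rewrite !scaleN1r addNr addrC.
Qed.

Let R_lie s u s' u' : R s u -> R s' u' ->
  exists2 q, q \in Q & R [lie s, s'] ([lie u, u'] - q).
Proof.
case=> t1 [c1 [n1 [w1 [[tT1 cC1 nN1 wW1] [-> def1 ->]]]]].
case=> t2 [c2 [n2 [w2 [[tT2 cC2 nN2 wW2] [-> def2 ->]]]]].
exists [lie n1, n2]; first exact: NN.
have [_ SCs _] := rCs.
have xT t : t \in T -> [lie x, t] \in W by rewrite memT => /andP[].
have tcW t c : t \in T -> c \in Cs -> [lie [lie x, t], c] \in W.
  by move=> tT cC; rewrite lieC rpredN; apply: CsUW => //; apply/inWU/xT.
exists [lie t1, t2], ([lie t1, c2] - [lie t2, c1] + [lie c1, c2]).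
exists ([lie t1, n2] - [lie t2, n1]).
exists ([lie [lie x, t1], c2] + [lie t1, w2] - ([lie [lie x, t2], c1] + [lie t2, w1])
        + ([lie [lie x, c1], c2] + [lie c1, [lie x, c2]])).
have tS1 := TS tT1; have tS2 := TS tT2; have cS1 := CsS cC1; have cS2 := CsS cC2.
split; split.
- exact: T_lie.
- by apply: memvD; [apply: memvB|]; apply: SCs => //; apply: CsS.
- by apply: memvB; apply: UN => //; apply: inSU.
- apply: memvD.
    by apply: memvB; (apply: memvD; [exact: tcW | apply: sW => //; exact: inSW]).
  apply: memvD; last by apply: CsUW => //; apply: xS.
  by rewrite lieC rpredN; apply: CsUW => //; apply: xS.
- by rewrite lieDl !linearD /= [[lie c1, t2]]lieC -!addrA.
- have xtc t c w n : [lie x, c] = w + n ->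
      [lie x, [lie t, c]] = [lie [lie x, t], c] + [lie t, w] + [lie t, n].
    by rewrite lie_der => ->; rewrite linearD addrA.
  have regroup (A B a b z : L) : A + a - (B + b) + z = A - B + z + (a - b).
    by rewrite opprD [A + a + _]addrACA [LHS]addrAC.
  rewrite (linearD (lie x)) (linearB (lie x)) /= (xtc _ _ _ _ def2).
  rewrite (xtc _ _ _ _ def1) (lie_der x c1 c2).
  exact: regroup.
by rewrite lieDl !linearD /= [[lie n1, t2]]lieC addrA addrK -addrA.
Qed.

Let psi s := addv_pi1 T Cs s + addv_pi2 W N [lie x, addv_pi2 T Cs s].

Let psi_linear : linear psi.
Proof.
by move=> a s s'; rewrite /psi !linearP /= scalerDr addrACA.
Qed.

Let psiP s : s \in S -> R s (psi s).
Proof.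
move=> sS; pose c := addv_pi2 T Cs s.
have cC : c \in Cs by apply: memv_pi2.
have sTC : s \in (T + Cs)%VS.
  by have [t [c' [tT cC' ->]]] := splitS sS; apply: memv_add.
have xcWN : [lie x, c] \in (W + N)%VS.
  by have /splitWN[w [n [wW nN ->]]] := xS (CsS cC); apply: memv_add.
exists (addv_pi1 T Cs s), c, (addv_pi2 W N [lie x, c]), (addv_pi1 W N [lie x, c]).
split; split.
- exact: memv_pi1.
- exact: cC.
- exact: memv_pi2.
- exact: memv_pi1.
- by rewrite addv_pi1_pi2.
- by rewrite addv_pi1_pi2.
- exact: erefl.
Qed.

Let psiU s : s \in S -> psi s \in U.
Proof.
case/psiP=> t [c [n [w [[tT cC nN wW] [_ _ ->]]]]].
by apply: memvD; [apply/inSU/TS | apply: NU].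
Qed.

(* U / C has trivial centre. Therefore psi, once known to respect brackets modulo C,
   respects the p-operation too: an element u of U is determined modulo C by ad u, and the
   p-operation acts as a p-th power of ad. *)
Let centreless z : z \in U -> (forall u, u \in U -> [lie z, u] \in C) -> z \in C.
Proof.
move=> zU zC; have [s [n [sS nN def_z]]] := splitU zU.
have zN m : m \in N -> [lie z, m] \in Q.
  by move=> mN; apply: NW; [apply: UN | case/memC: (zC m (NU mN))].
have sC : s \in C.
  apply: CsC; apply/memv_centraliser_mod; split=> // m mN.
  have -> : [lie s, m] = [lie z, m] - [lie n, m] by rewrite def_z lieDl addrK.
  by apply: memvB; [apply: zN | apply: NN].
rewrite def_z; apply: memvD => //; apply: QC; apply: chief_centre => // u uU.
have nuN : [lie n, u] \in N by rewrite lieC rpredN; apply: UN.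
apply: NW => //; suff /memC[] : [lie n, u] \in C by [].
have -> : [lie n, u] = [lie z, u] - [lie s, u] by rewrite def_z lieDl addrC addKr.
apply: memvB; first exact: zC.
by rewrite lieC rpredN; case: rC => _ UC _; apply: UC.
Qed.

Let quotient_map_psi (A : restrictedLieType F p) (f : {linear L -> A}) :
  quotient_map U C f -> exists g : {linear L -> A}, quotient_map S D g.
Proof.
move=> [fM fp fker fsurj].
pose psiL := GRing.isLinear.Build F L L *:%R psi psi_linear.
pose psi' : {linear L -> L} := HB.pack psi psiL.
have [sS pS] := rS; have [sU pU] := rU.
have fR s u : R s u -> u \in U -> s \in S -> f (psi s) = f u.
  move=> Ru uU sS'; apply/eqP; rewrite -subr_eq0 -linearB fker.
    exact: R_uniq Ru (psiP sS').
  by apply: memvB => //; apply: psiU.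
have fpsiM s s' : s \in S -> s' \in S -> f (psi [lie s, s']) = [lie f (psi s), f (psi s')].
  move=> sS1 sS2; have [q qQ Rq] := R_lie (psiP sS1) (psiP sS2).
  have uU : [lie psi s, psi s'] \in U by apply: sU; apply: psiU.
  rewrite (fR _ _ Rq); last by apply: sS.
    rewrite linearB fM ?psiU //= -[RHS]subr0; congr (_ - _); apply/eqP.
    by rewrite fker ?QC ?QU.
  by apply: memvB => //; apply: QU.
have fsurjS a : exists2 s, s \in S & f (psi s) = a.
  have [u uU <-] := fsurj a; have [s [n [sS' nN def_u]]] := splitU uU.
  have [t [c [tT cC def_s]]] := splitS sS'; have [c' [w [cC' wW defc']]] := onto nN.
  have tnU : t + n \in U by apply: memvD; [apply/inSU/TS | apply: NU].
  have tcS : t + c' \in S by apply: memvD; [apply: TS | apply: CsS].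
  exists (t + c') => //; rewrite (@fR _ (t + n)) //; last by exists t, c', n, w.
  apply/eqP; rewrite eq_sym -subr_eq0 -linearB fker; last exact: memvB.
  have -> : u - (t + n) = c.
    by rewrite def_u def_s opprD addrACA subrr addr0 addrAC subrr add0r.
  exact: CsC.
exists (f \o psi'); split=> //=.
- move=> s sS'; apply/eqP; rewrite -subr_eq0.
  have psS : ppow s \in S by apply: pS.
  have zU : psi (ppow s) - ppow (psi s) \in U.
    by apply: memvB; [apply: psiU | apply/pU/psiU].
  rewrite -fp ?psiU // -linearB fker //; apply: centreless => // u uU.
  have [y yS fy] := fsurjS (f u).
  rewrite -fker ?sU // fM // -fy linearB lieDl lieNl -fpsiM // fp ?psiU //.
  rewrite !ppow_ad subr_eq0; apply/eqP.
  suff iterE k : f (psi (iter k (lie s) y)) = iter k (lie (f (psi s))) (f (psi y)).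
    exact: iterE.
  have itS k' : iter k' (lie s) y \in S by apply: iter_lie_mem => // v; apply: sS.
  by elim: k => //= k <-; rewrite fpsiM.
move=> s sS'; rewrite fker ?psiU //; apply/idP/idP => [psC | /memv_capP[sT sCs]].
  have [t [c [n [w [[tT cC nN wW] [def_s defc def_psi]]]]]] := psiP sS'.
  have nQ : n \in Q.
    apply: NW => //; have -> : n = psi s - t by rewrite def_psi addrC addKr.
    by apply: memvB; [case/memC: psC | apply/inSW/TS].
  have tCs : t \in Cs.
    apply/memv_centraliser_mod; split=> [|m mN]; first exact: TS.
    have -> : t = psi s - n by rewrite def_psi addrK.
    by rewrite lieDl lieNl; apply: memvB; [case/memC: psC => _; apply | apply: NN].
  apply/memv_capP; rewrite def_s; split; apply: memvD => //.
  by rewrite memT CsS // defc memvD // inQW.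
suff : psi s - s \in C by rewrite rpredBr // CsC.
apply: R_uniq (psiP sS'); exists s, 0, 0, 0.
by split; split; rewrite ?mem0v ?addr0 ?linear0.
Qed.

(** The failure of the derivation to be inner makes a quotient of S reappear as a
quotient of U by an ideal inside the proper subalgebra S + Q. *)
Lemma deviation_common_quotient : exists D C,
  [/\ restricted_ideal S D, restricted_ideal U C, (C <= W)%VS &
    forall (A : restrictedLieType F p) (f : {linear L -> A}),
    quotient_map U C f -> exists g : {linear L -> A}, quotient_map S D g].
Proof. exists D, C; split; [exact: rD | exact: rC | exact: capvSl |].
exact: quotient_map_psi. Qed.

End ChiefFactor.

(** * Covering subalgebras *)

Section Covering.
Variables (F : fieldType) (p : nat).
Hypothesis charFp : p \in [pchar F].
Variables (L : restrictedLieType F p) (H : restrictedLieType F p -> Prop).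
Hypothesis isoH : forall A B : restrictedLieType F p, isomorphic A B -> H A -> H B.
Hypothesis atomH : forall A : restrictedLieType F p, atom A -> H A.
Implicit Types (x y z : L) (U V J K S : {vspace L}).

Definition has_quotient U J :=
  exists (A : restrictedLieType F p) (f : {linear L -> A}), quotient_map U J f /\ H A.

Lemma has_quotient_map U J (A : restrictedLieType F p) (f : {linear L -> A}) :
  restricted_sub U -> has_quotient U J -> quotient_map U J f -> H A.
Proof. by move=> rU [B [g [qg HB]]] qf; apply: isoH HB; apply: quotient_map_iso qg qf. Qed.

(** Correcting x by a in N with [e, a] = [x, e] modulo S + Q makes the derivation
s |-> [x, s] vanish at e. If it then did not vanish on S, a quotient of S in H would be
isomorphic to some U / C with C <= S + Q, contradicting that S covers U / C. *)
Lemma covering_step U S x :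
    restricted_sub U -> soluble_sub U -> restricted_sub S -> (S <= U)%VS -> S <> U ->
    (forall D, restricted_ideal S D -> has_quotient S D) ->
    (forall J, restricted_ideal U J -> has_quotient U J -> (S + J)%VS = U) ->
    (forall s, s \in S -> [lie x, s] \in U) ->
  exists V a, [/\ restricted_sub V, (S <= V)%VS, (V <= U)%VS & V <> U] /\
    (a \in U /\ forall s, s \in S -> [lie x + a, s] \in V).
Proof.
move=> rU solU rS SU SneU HS covU xS.
have [Q [N [UNQ SQ]]] := exists_complemented_factor charFp rU solU rS SU SneU.
have [rQ rN QN _ _ SN _] := UNQ.
have [central|noncentral] := classic (forall u n, u \in U -> n \in N -> [lie u, n] \in Q).
  have rW := central_restricted_ideal rS SU UNQ central.
  have [A [f qf]] := exists_quotient_map rU rW.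
  have HA := atomH (central_quotient_atom SU UNQ central SQ qf).
  case: SQ; rewrite -[RHS](covU _ rW); first by rewrite addvA addvv.
  by exists A, f.
have [e [eS einj ees]] := exists_regular_in_S charFp rU rS SU UNQ noncentral
  (soluble_subS SU solU).
have eU := subvP SU e eS.
have [w [n [wW nN xe]]] : exists w n, [/\ w \in (S + Q)%VS, n \in N & [lie x, e] = w + n].
  have := xS e eS; rewrite -{1}SN => /memv_addP[s sS [n nN ->]].
  by exists s, n; split=> //; apply: (subvP (addvSl _ _)).
have [a aN na] := regular_surjective UNQ eU einj nN.
have aU : a \in U by case: rN => /subvP NU _ _; apply: NU.
have [sU _] := rU.
have xaS s : s \in S -> [lie x + a, s] \in U.
  by move=> sS; rewrite lieDl memvD ?xS //; apply: sU => //; apply: (subvP SU).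
have xae : [lie x + a, e] \in (S + Q)%VS.
  rewrite lieDl [[lie a, e]]lieC xe -addrA; apply: memvD => //.
  exact: (subvP (addvSr _ _)).
exists (S + Q)%VS, a; split; [split=> // | split=> // s sS].
- exact: restricted_sub_add rS SU rQ.
- exact: addvSl.
- by rewrite -SN addvS.
apply/negPn/negP => sW.
have [D [C [rD rC CW quots]]] := deviation_common_quotient charFp rU rS SU UNQ noncentral
  xaS eS xae einj ees (ex_intro2 _ _ s sS sW).
have [A [f qf]] := exists_quotient_map rU rC; have [g qg] := quots A f qf.
apply: SQ; apply/eqP; rewrite eqEsubv -{1}SN addvS //= -{1}(covU C rC).
  by rewrite subv_add addvSl CW.
by exists A, f; split=> //; apply: has_quotient_map (HS D rD) qg.
Qed.

Lemma covering_normaliser K S :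
    restricted_sub S -> soluble_sub K ->
    (forall D, restricted_ideal S D -> has_quotient S D) ->
    (forall U J, restricted_sub U -> (S <= U)%VS -> (U <= K)%VS ->
      restricted_ideal U J -> has_quotient U J -> (S + J)%VS = U) ->
  forall U x, restricted_sub U -> (S <= U)%VS -> (U <= K)%VS ->
    (forall s, s \in S -> [lie x, s] \in U) ->
  exists2 k, k \in K & forall s, s \in S -> [lie x + k, s] \in S.
Proof.
move=> rS solK HS cov U; have [n] := ubnP (\dim U).
elim: n U => // n IHn U ltUn x rU SU UK xU.
have [SeqU|SneU] := classic (S = U).
  by exists 0; rewrite ?mem0v // => s sS; rewrite addr0 SeqU xU.
have [V [a [[rV SV VU VneU] [aU xaV]]]] :=
  covering_step rU (soluble_subS UK solK) rS SU SneU HS (fun J => @cov U J rU SU UK) xU.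
have VK := subv_trans VU UK.
have ltVn : (\dim V < n)%N.
  apply: (@leq_trans (\dim U)); last by rewrite -ltnS.
  rewrite ltn_neqAle dimvS // andbT.
  by apply/negP => dimVU; apply: VneU; apply/eqP; rewrite eqEdim VU (eqP dimVU) /=.
have [k kK xak] := IHn V ltVn (x + a) rV SV VK xaV.
by exists (a + k); rewrite ?addrA // memvD // (subvP UK).
Qed.

End Covering.

Lemma derived_in_ambient (F : fieldType) (p : nat) (L : restrictedLieType F p)
    (K : psubalgebra L) : soluble (subalg_of K) -> soluble_sub (psub_space K).
Proof.
case=> n Kn; exists n; apply/eqP; rewrite -subv0.
suff : (derived (psub_space K) n <= in_ambient (derived_series (subalg_of K) n))%VS.
  by rewrite Kn /in_ambient limg0.
elim: {Kn}n => [|n IHn].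
  apply/subvP => x xK; rewrite -[x]/(subalg_val (Subvs xK : subalg_of K)).
  by rewrite mem_in_ambient memvf.
apply: lie_prod_sub => u v /(subvP IHn)/memv_imgP[a aD ->] /(subvP IHn)/memv_imgP[b bD ->].
rewrite !lfunE -[X in X \in _]/(subalg_val [lie a, b]) mem_in_ambient.
exact: mem_lie_prod.
Qed.

(** The covering property of S in K is restated for subspaces of L before
[covering_normaliser] is applied to x and U = K: if x + k normalises S, then
x = - k + (x + k) is in K plus the normaliser. *)
Theorem theorem7p2 (F : fieldType) (p : nat) (charFp : p \in [pchar F])
    (H : restrictedLieType F p -> Prop) (homH : p_homomorph H)
    (atomH : forall A : restrictedLieType F p, atom A -> H A)
    (L : restrictedLieType F p) (K : pideal L) (solK : soluble (subalg_of K))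
    (S : psubalgebra (subalg_of K)) (covS : covering_subalgebra H S) :
  (fullv : {vspace L}) = (K + normaliser (in_ambient S))%VS.
Proof.
have [HS cov] := covS; have isoH := p_homomorph_iso homH.
have [[_ iM ip] iinj] := subalg_val_morphism K.
set i := (@subalg_val F p L K) in iM ip iinj.
have iK a : i a \in psub_space K by apply: subvsP.
have inK u : u \in psub_space K -> exists a, i a = u by move=> uK; exists (Subvs uK).
have memS s : s \in in_ambient S <-> exists2 a, a \in psub_space S & i a = s.
  split=> [/memv_imgP[a aS ->] | [a aS <-]]; first by exists a; rewrite // lfunE.
  by rewrite mem_in_ambient.
have rS : restricted_sub (in_ambient S).
  split=> [_ _ /memS[a aS <-] /memS[b bS <-] | _ /memS[a aS <-]]; apply/memS.
    by exists [lie a, b]; [apply: psub_lie | apply: iM].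
  by exists (ppow a); [apply: psub_ppow | apply: ip].
pose j V : {linear subalg_of V -> L} := (@subalg_val F p L K \o @subalg_val F p _ V).
have jM V : {morph j V : a b / [lie a, b]} by [].
have jp V : {morph j V : a / ppow a} by [].
have jinj V : injective (j V) by move=> a b /iinj/val_inj.
have quotS D : restricted_ideal (in_ambient S) D -> has_quotient H (in_ambient S) D.
  move=> rD; have [|J [_ [f qf]]] := quotient_of_embedding (jM S) (jp S) (@jinj S) _ rD.
    move=> s; rewrite memS; split=> [[a aS <-] | [a <-]]; first by exists (Subvs aS).
    by exists (subalg_val a) => //; apply: subvsP.
  by exists (quot_of J), f; split=> //; apply: p_homomorph_quot.
have covL U J : restricted_sub U -> (in_ambient S <= U)%VS -> (U <= psub_space K)%VS ->
    restricted_ideal U J -> has_quotient H U J -> (in_ambient S + J)%VS = U.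
  move=> [sU pU] SU UK rJ HUJ; have [JU _ _] := rJ.
  pose VV := (linfun i @^-1: U)%VS.
  have memV a : (a \in VV) = (i a \in U) by rewrite -memv_preim lfunE.
  have V_lie : subalgebra VV by move=> a b; rewrite !memV iM; apply: sU.
  have V_ppow a : a \in VV -> ppow a \in VV by rewrite !memV ip; apply: pU.
  pose V := PSubalgebra V_lie V_ppow.
  have [|I [memI [f qf]]] := quotient_of_embedding (jM V) (jp V) (@jinj V) _ rJ.
    move=> u; split=> [uU | [a <-]]; last by rewrite -memV; apply: subvsP.
    have [a def_u] := inK u (subvP UK u uU).
    have aV : a \in VV by rewrite memV def_u.
    by exists (Subvs aV).
  have SV : (S <= V)%VS.
    by apply/subvP => s sS; rewrite memV; apply: (subvP SU); apply/memS; exists s.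
  have /vspaceP defV := cov V SV I (has_quotient_map isoH (conj sU pU) HUJ qf).
  apply/eqP; rewrite eqEsubv subv_add SU JU /=; apply/subvP => u uU.
  have [a def_u] := inK u (subvP UK u uU).
  have : a \in VV by rewrite memV def_u.
  rewrite -[VV]/(psub_space V) -defV -def_u => /memv_addP[s sS [_ /memv_imgP[b bI ->] ->]].
  rewrite /i linearD lfunE; apply: memv_add; first by apply/memS; exists s.
  by have := bI; rewrite memI.
apply/eqP; rewrite eqEsubv subvf andbT; apply/subvP => x _.
have rK : restricted_sub (psub_space K) by split; [apply: psub_lie | apply: psub_ppow].
have [||k kK xk] := covering_normaliser charFp isoH atomH rS (derived_in_ambient solK)
  quotS covL rK _ (subvv _) (x := x).
- by apply/subvP => _ /memS[a _ <-].
- by move=> _ /memS[a _ <-]; apply: pideal_lie; apply: iK.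
by rewrite -[x](addrK k) addrC memv_add ?rpredN //; apply/memv_normaliser.
Qed.
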